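(* Let the Standing Assumption hold, and let $z\in\mathbb R^n$ with $\eta\coloneq\eta(z)\ne0$. Write $M\coloneq M(z)$. 1. There exists $P\in\mathbb R^{n\times n}$ with $M+P\preceq0$ and $P\eta=0$. One such $P$ is obtained as follows. Let $\mathcal W\subseteq\mathbb R^n$ be any subspace with $\mathbb R^n=\operatorname{span}\{\eta\}\oplus\mathcal W$. Let $w\in\mathbb R^n$ satisfy $\mathcal W^\perp=\operatorname{span}\{w\}$. Then $w^{\mathsf T}\eta\ne0$; set $\mathcal P\coloneq\frac{\eta w^{\mathsf T}}{w^{\mathsf T}\eta}$. Define the symmetric matrix $P_{\mathsf H}\coloneq -M_{\mathsf H}+\mathcal P^{\mathsf T}M_{\mathsf H}\mathcal P$. There exists a skew-symmetric matrix $P_{\mathsf S}$ with $P_{\mathsf S}\eta=-P_{\mathsf H}\eta$, and for any such $P_{\mathsf S}$ the matrix $P\coloneq P_{\mathsf H}+P_{\mathsf S}$ satisfies $M+P\preceq0$ and $P\eta=0$. 2. If moreover $\eta^{\mathsf T}M_{\mathsf H}\eta\ne0$, then $P\coloneq -M_{\mathsf H}+\dfrac{M_{\mathsf H}\eta\eta^{\mathsf T}M_{\mathsf H}}{\eta^{\mathsf T}M_{\mathsf H}\eta}$ satisfies $M+P\preceq0$ and $P\eta=0$.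
   Context: Setting. Let $n,m$ be positive integers. Let $\mathcal H\colon\mathbb R^n\to\mathbb R$ be continuously differentiable with $\mathcal H\ge 0$, and set $\eta\coloneq\nabla\mathcal H\colon\mathbb R^n\to\mathbb R^n$. Let $f\colon\mathbb R^n\to\mathbb R^n$ and $B\colon\mathbb R^n\to\mathbb R^{n\times m}$. Consider the system $\dot z = f(z)+B(z)u$, $y=B(z)^{\mathsf T}\eta(z)$. Notation. For $A\in\mathbb R^{n\times n}$: $A_{\mathsf H}\coloneq\tfrac12(A+A^{\mathsf T})$, $A_{\mathsf S}\coloneq\tfrac12(A-A^{\mathsf T})$, and $A\preceq0$ means $x^{\mathsf T}Ax\le0$ for all $x\in\mathbb R^n$. Property (P): there exist $p\in\mathbb N$ and $\ell\colon\mathbb R^n\to\mathbb R^p$ with $\eta(z)^{\mathsf T}f(z)=-\ell(z)^{\mathsf T}\ell(z)$ for all $z$. Standing Assumption: property (P) holds; $f,\eta$ are $C^1$; $\eta\colon\mathbb R^n\to\mathbb R^n$ is bijective; $f(\eta^{-1}(0))=0$; and $D\eta(z)$ is invertible for all $z\in\mathbb R^n$. Definition of $M$. Under the Standing Assumption $\eta^{-1}$ is $C^1$, and $M(z)\coloneq\int_0^1 D(f\circ\eta^{-1})(s\,\eta(z))\,\mathrm ds=\int_0^1 Df(\zeta_s)D\eta(\zeta_s)^{-1}\,\mathrm ds$, where $\zeta_s\coloneq\eta^{-1}(s\eta(z))$. This satisfies $f(z)=M(z)\eta(z)$ for all $z$. *)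

(* Defs.v *)
From HB Require Import structures.
From mathcomp Require Import all_boot all_order all_algebra.
From mathcomp Require Import all_classical all_reals all_analysis.
Set Implicit Arguments. Unset Strict Implicit. Unset Printing Implicit Defensive.
Import Order.TTheory GRing.Theory Num.Theory.
Import numFieldNormedType.Exports.
Local Open Scope classical_set_scope.
Local Open Scope ring_scope.

Section Defs.
Variable R : realType.

(* Jacobian matrix (standard orientation): (jac F x) i j = dF_i/dx_j (x),
   i.e. jac F x *m v = 'd F x v. *)
Definition jac (n m : nat) (F : 'cV[R]_n -> 'cV[R]_m) (x : 'cV[R]_n) : 'M[R]_(m, n) :=
  \matrix_(i < m, j < n) ('d F x (delta_mx j 0)) i 0.

Definition grad (n : nat) (H : 'cV[R]_n -> R) (x : 'cV[R]_n) : 'cV[R]_n :=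
  \col_(i < n) ('d H x (delta_mx i 0)).

Definition C1 (n m : nat) (F : 'cV[R]_n -> 'cV[R]_m) : Prop :=
  (forall x, differentiable F x) /\ continuous (jac F).
Definition C1s (n : nat) (H : 'cV[R]_n -> R) : Prop :=
  (forall x, differentiable H x) /\ continuous (grad H).

Definition propertyP (n : nat) (eta f : 'cV[R]_n -> 'cV[R]_n) : Prop :=
  exists (p : nat) (l : 'cV[R]_n -> 'cV[R]_p),
    forall x, (eta x)^T *m f x = - ((l x)^T *m l x).

Definition symH (n : nat) (A : 'M[R]_n) : 'M[R]_n := 2^-1 *: (A + A^T).
Definition skewS (n : nat) (A : 'M[R]_n) : 'M[R]_n := 2^-1 *: (A - A^T).
Definition nsd (n : nat) (A : 'M[R]_n) : Prop :=
  forall x : 'cV[R]_n, (x^T *m A *m x) 0 0 <= 0.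

Definition Mmat (n : nat) (f eta etainv : 'cV[R]_n -> 'cV[R]_n) (z : 'cV[R]_n)
  : 'M[R]_n :=
  \matrix_(i < n, j < n)
     (\int[@lebesgue_measure R]_(s in `[0%R, 1%R]) (jac (f \o etainv) (s *: eta z)) i j).

Definition orth_is_span (n : nat) (W : {vspace 'cV[R]_n}) (w : 'cV[R]_n) : Prop :=
  forall v : 'cV[R]_n, (forall x, x \in W -> x^T *m v = 0) <-> v \in <[w]>%VS.

End Defs.

(* Main.v *)
Require Import Defs.
From HB Require Import structures.
From mathcomp Require Import all_boot all_order all_algebra.
From mathcomp Require Import all_classical all_reals all_analysis.
From mathcomp Require Import ring lra.
Import Order.TTheory GRing.Theory Num.Theory.
Import numFieldNormedType.Exports.
Local Open Scope classical_set_scope.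
Local Open Scope ring_scope.

(* Everything follows from [M(z) eta(z) = f(z)], which gives
   [eta^T M_H eta = eta^T f = - |l|^2 <= 0]: each [M + P] has, up to a skew part,
   the quadratic form [x |-> t(x)^2 eta^T M_H eta] or
   [x |-> (eta^T M_H x)^2 / (eta^T M_H eta)] with [t] linear.

   The identity [M(z) eta(z) = f(z)] is the fundamental theorem of calculus for
   [f o eta^-1] along the segment from [0] to [eta(z)], and needs [eta^-1] to be
   C1. Continuity of [eta^-1] at [eta(x0)]: for [y] close to [eta(x0)], the
   squared distance from [eta(x)] to [y] has a minimiser on a small closed ball
   around [x0]; as [D eta(x0)] is invertible, it is not on the boundary, and as
   [D eta] is invertible at the minimiser, the minimum is [0]. *)

(** * Max norm on matrices: entrywise limits, compact balls, continuity of inversion *)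

Section MatrixNorm.
Context {R : realType}.

Lemma mx_norm_entry {m n : nat} (A : 'M[R]_(m, n)) i j : `|A i j| <= `|A|.
Proof.
rewrite [leRHS]/Num.Def.normr/= mx_normrE.
by apply: (@le_bigmax _ _ _ _ (fun ij : 'I_m * 'I_n => `|A ij.1 ij.2|) (i, j)).
Qed.

Lemma mx_norm_le {m n : nat} (A : 'M[R]_(m, n)) (e : R) :
  0 <= e -> (forall i j, `|A i j| <= e) -> `|A| <= e.
Proof.
move=> e0 Ae; rewrite [leLHS]/Num.Def.normr/= mx_normrE.
by apply: bigmax_le => // -[i j] _; exact: Ae.
Qed.

Lemma mx_norm_mul {m n p : nat} (A : 'M[R]_(m, n)) (B : 'M[R]_(n, p)) :
  `|A *m B| <= n%:R * `|A| * `|B|.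
Proof.
apply: mx_norm_le => [|i j]; first by rewrite !mulr_ge0.
rewrite mxE (le_trans (ler_norm_sum _ _ _))//.
apply: (@le_trans _ _ (\sum_(k < n) (`|A| * `|B|))).
  by apply: ler_sum => k _; rewrite normrM ler_pM// mx_norm_entry.
by rewrite sumr_const card_ord -(mulr_natl (_ * _)) mulrA.
Qed.

Lemma cvg_mx {T : Type} {F : set_system T} {FF : Filter F} {m n : nat}
    (G : T -> 'M[R]_(m, n)) (L : 'M[R]_(m, n)) :
  (forall i j, G x i j @[x --> F] --> L i j) -> G @ F --> L.
Proof.
move=> GL; apply/cvgrPdist_le => e e0.
have : \forall x \near F, forall ij : 'I_m * 'I_n, `|L ij.1 ij.2 - G x ij.1 ij.2| <= e.
  apply: filter_forall => -[i j] /=.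
  by move/cvgrPdist_le : (GL i j) => /(_ _ e0).
apply: filterS => x H; apply: mx_norm_le; first exact: ltW.
by move=> i j; rewrite !mxE; exact: (H (i, j)).
Qed.

Lemma continuous_mulmx {T : topologicalType} {m n p : nat}
    (A : T -> 'M[R]_(m, n)) (B : T -> 'M[R]_(n, p)) :
  continuous A -> continuous B -> continuous (fun x => A x *m B x).
Proof.
move=> cA cB x; apply: (@cvg_mx _ (nbhs x)) => i j; rewrite mxE.
under eq_fun do rewrite mxE.
apply: (@cvg_big R _ +%R 0 xpredT (@add_continuous R) T (nbhs x) _
  (fun k y => A y i k * B y k j)) => k _.
apply: cvgM.
  by apply: (cvg_comp A (fun M : 'M[R]_(m, n) => M i k) (cA x)); exact: coord_continuous.
by apply: (cvg_comp B (fun M : 'M[R]_(n, p) => M k j) (cB x)); exact: coord_continuous.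
Qed.

(** In the max norm a closed ball is a box, that is, the image under transposition of a product of
    segments, to which [rV_compact] applies. *)
Lemma compact_cV_ball {n : nat} (x : 'cV[R]_n) (r : R) :
  0 <= r -> compact [set y : 'cV[R]_n | `|y - x| <= r].
Proof.
move=> r0.
pose K := [set v : 'rV[R]_n | forall i, `[x i 0 - r, x i 0 + r]%classic (v ord0 i)].
have cK : compact K.
  apply: (@rV_compact _ _ (fun i => `[x i 0 - r, x i 0 + r]%classic)) => i.
  exact: segment_compact.
have -> : [set y : 'cV[R]_n | `|y - x| <= r] = (fun v : 'rV[R]_n => v^T) @` K.
  apply/seteqP; split => [y /= yx|_ /= [v vK <-]].
    exists y^T; last by rewrite trmxK.
    move=> i /=; rewrite mxE in_itv/= -ler_distl.
    by apply: le_trans yx; have := mx_norm_entry (y - x) i 0; rewrite !mxE.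
  apply: mx_norm_le => // i j; rewrite ord1 !mxE.
  by have := vK i; rewrite /= in_itv/= -ler_distl.
apply: continuous_compact cK; apply: continuous_subspaceT => v.
apply: (@cvg_mx _ (nbhs v)) => i j; rewrite mxE; under eq_fun do rewrite mxE.
exact: coord_continuous.
Qed.

(** With [A = J x], the identity [A^-1 - J(y)^-1 = J(y)^-1 (J(y) - A) A^-1] bounds the difference by
    [C |J(y)^-1| |A - J(y)|]. The unknown factor [|J(y)^-1|] is first bounded by [2 |A^-1|]. *)
Lemma continuous_invmx {T : topologicalType} {n : nat} (J : T -> 'M[R]_n) :
  (forall x, J x \in unitmx) -> continuous J -> continuous (fun x => invmx (J x)).
Proof.
move=> Ju cJ x; set A := J x.
pose C : R := n%:R * n%:R * `|invmx A|.
have C0 : 0 <= C by rewrite !mulr_ge0.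
have bound y : `|invmx A - invmx (J y)| <= C * `|invmx (J y)| * `|A - J y|.
  have -> : invmx A - invmx (J y) = invmx (J y) *m (J y - A) *m invmx A.
    by rewrite mulmxBr mulVmx// mulmxBl mul1mx mulmxK ?Ju.
  rewrite -[`|A - J y|]normrN opprB.
  apply: le_trans (mx_norm_mul _ _) _.
  apply: (@le_trans _ _ (n%:R * (n%:R * `|invmx (J y)| * `|J y - A|) * `|invmx A|)).
    by rewrite ler_wpM2r// ler_wpM2l// mx_norm_mul.
  by rewrite /C le_eqVlt; apply/orP; left; apply/eqP; ring.
have C1 : 0 < 2 * (C + 1) by lra.
apply/(@cvgrPdist_le _ _ _ (nbhs x)) => e e0.
(* The entry [1] of the minimum gives [C a b <= b / 2], whence [b <= 2 |A^-1|]; the other entry then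
   brings [C a b] below [e]. *)
pose d := Num.min 1 (e / (`|invmx A| + 1)) / (2 * (C + 1)).
have d0 : 0 < d.
  by rewrite divr_gt0// lt_min ltr01/= divr_gt0// ltr_wpDl.
have /cvgrPdist_le/(_ _ d0) := cJ x.
apply: filterS => y; rewrite -/A => Ay.
have := bound y; set a := `|A - J y| in Ay *; set b := `|invmx (J y)|.
have [a0 b0] : 0 <= a /\ 0 <= b by split; exact: normr_ge0.
have na0 : 0 <= `|invmx A| by [].
have dC : d * (2 * (C + 1)) = Num.min 1 (e / (`|invmx A| + 1)).
  by rewrite /d mulfVK// gt_eqF.
have aC1 : a * (2 * (C + 1)) <= 1.
  by apply: (@le_trans _ _ (d * (2 * (C + 1)))); rewrite ?ler_pM2r// dC ge_min lexx.
have aCe : a * (2 * (C + 1)) * (`|invmx A| + 1) <= e.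
  rewrite -ler_pdivlMr; last by rewrite ltr_wpDl.
  by apply: (@le_trans _ _ (d * (2 * (C + 1)))); rewrite ?ler_pM2r// dC ge_min lexx orbT.
move=> bd; apply: (le_trans bd).
have : b <= `|invmx A| + `|invmx A - invmx (J y)|.
  rewrite -[`|invmx A - _|]normrN opprB.
  by have := ler_normD (invmx A) (invmx (J y) - invmx A); rewrite subrKC.
move: bd; set D := `|invmx A - _| => bd bD.
have Cab : C * b * a <= b / 2 by nra.
have b2 : b <= 2 * `|invmx A| by lra.
have : C * a * b <= C * a * (2 * `|invmx A|) by rewrite ler_wpM2l// mulr_ge0.
nra.
Qed.

End MatrixNorm.

(** * Jacobians as first-order approximations, and derivatives along lines *)

Section Jacobian.
Context {R : realType}.

Lemma diff_jac {n m : nat} (F : 'cV[R]_n -> 'cV[R]_m) x v : 'd F x v = jac F x *m v.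
Proof.
have -> : v = \sum_j v j 0 *: delta_mx j 0.
  rewrite {1}[v]matrix_sum_delta; apply: eq_bigr => j _.
  by rewrite big_ord1.
rewrite linear_sum mulmx_sumr; apply: eq_bigr => j _.
rewrite linearZ -scalemxAr; congr (_ *: _).
by apply/colP => i; rewrite -colE !mxE.
Qed.

Lemma jac_approx {n m : nat} (F : 'cV[R]_n -> 'cV[R]_m) x : differentiable F x ->
  forall e : R, 0 < e ->
  \forall y \near x, `|F y - F x - jac F x *m (y - x)| <= e * `|y - x|.
Proof.
move=> dF e e0.
have /eqaddoP/(_ _ e0) := diff_locally dF.
move=> H; apply/nbhs0P; apply: filterS H => h /=.
by rewrite !fctE /= [x + h]addrC addrK diff_jac opprD addrA.
Qed.

(** Converse of [jac_approx]: a continuous linear map that approximates the increment up to [o(|h|)]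
    is the differential, by uniqueness. *)
Lemma approx_jac {n m : nat} (F : 'cV[R]_n -> 'cV[R]_m) x (A : 'M[R]_(m, n)) :
  (forall e : R, 0 < e ->
    \forall y \near x, `|F y - F x - A *m (y - x)| <= e * `|y - x|) ->
  differentiable F x /\ jac F x = A.
Proof.
move=> FA.
have cA : continuous (mulmx A : 'cV[R]_n -> 'cV[R]_m).
  by apply: continuous_mulmx; [exact: cst_continuous|move=> y; exact: cvg_id].
pose V : normedModType R := 'cV[R]_n; pose W : normedModType R := 'cV[R]_m.
have oA : (F : V -> W) \o shift (x : V) = cst (F x) + (mulmx A : V -> W) +o_ (0 : V) id.
  apply/eqaddoP => e e0.
  have /nbhs0P := FA _ e0; apply: filterS => h /=.
  by rewrite !fctE /= [x + h]addrC addrK opprD addrA.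
have dE := diff_unique cA oA.
split.
  by apply/diff_locallyP; rewrite dE.
by apply/matrixP => i j; rewrite mxE dE /= -colE mxE.
Qed.

Lemma jac_comp {n m p : nat} (F : 'cV[R]_n -> 'cV[R]_m) (G : 'cV[R]_m -> 'cV[R]_p) x :
  differentiable F x -> differentiable G (F x) ->
  jac (G \o F) x = jac G (F x) *m jac F x.
Proof.
move=> dF dG; apply/matrixP => i j.
by rewrite mxE diff_comp//= !diff_jac mulmxA -colE mxE.
Qed.

Lemma is_derive_line {n m : nat} (F : 'cV[R]_n -> 'cV[R]_m) x v (t : R) i :
  differentiable F (x + t *: v) ->
  is_derive t 1 (fun s : R => F (x + s *: v) i 0) ((jac F (x + t *: v) *m v) i 0).
Proof.
move=> dF.
have dl : is_diff t (fun s : R => x + s *: v) (fun s : R => s *: v).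
  exact: (is_diff_eq (is_diffD (is_diff_cst x t) (is_diff_scalel t v)) (add0r _)).
(* A coordinate is a continuous linear form, hence its own differential. *)
have dc : is_diff (F (x + t *: v)) (fun y : 'cV[R]_m => y i 0) (fun y => y i 0).
  have lin_c : linear (fun y : 'cV[R]_m => y i 0 : R) by move=> a y z; rewrite !mxE.
  pose cM := GRing.isLinear.Build _ _ _ _ _ lin_c.
  pose c : {linear 'cV[R]_m -> R} := HB.pack (fun y : 'cV[R]_m => y i 0 : R) cM.
  have cc : continuous c by exact: coord_continuous.
  by apply: DiffDef; [exact: (linear_differentiable _ cc)|exact: (diff_lin _ cc)].
have dF' := differentiableP dF.
have dG := @is_diff_comp _ _ _ _ _ _ _ _ _ dl dF'.
have dH := @is_diff_comp _ _ _ _ _ _ _ _ _ dG dc.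
apply: DeriveDef; first by apply/diff_derivable; exact: ex_diff.
rewrite deriveE; last exact: ex_diff.
by rewrite diff_val /= scale1r diff_jac.
Qed.

End Jacobian.

(** * The inverse of a differentiable bijection with invertible Jacobians *)

Section InverseFunction.
Context {R : realType} {n : nat}.
Implicit Types (F G : 'cV[R]_n -> 'cV[R]_n) (x y : 'cV[R]_n).

(** Invertibility gives [|h| <= C |J h|]. A linearisation error of at most [|h| / (2 C)] costs only
    half of [|h|], which is absorbed on the left and leaves the constant [2 C]. *)
Lemma jac_unit_expand F x : differentiable F x -> jac F x \in unitmx ->
  exists2 C : R, 0 < C & \forall y \near x, `|y - x| <= C * `|F y - F x|.
Proof.
move=> dF uF; set B := invmx (jac F x).
pose C : R := n%:R * `|B| + 1.
have C0 : 0 < C by rewrite ltr_wpDl// mulr_ge0.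
have e0 : 0 < (2 * C)^-1 by rewrite invr_gt0 mulr_gt0.
exists (2 * C); first by rewrite mulr_gt0.
have := jac_approx F x dF _ e0; apply: filterS => y.
set D := F y - F x; set h := y - x => Dh.
have : `|h| <= C * `|jac F x *m h|.
  rewrite -{1}[h](mulKmx uF) -/B; apply: (le_trans (mx_norm_mul _ _)).
  by rewrite ler_wpM2r// /C lerDl.
have : `|jac F x *m h| <= `|D| + `|D - jac F x *m h|.
  by rewrite -{1}[jac F x *m h](subKr D) ler_normB.
move: Dh; set a := `|D|; set b := `|h|; set c := `|D - _|; set d := `|jac F x *m h|.
move=> cb dac bd.
have : C * d <= C * (a + (2 * C)^-1 * b).
  by rewrite ler_pM2l// (le_trans dac)// lerD2l.
have -> : C * (a + (2 * C)^-1 * b) = C * a + b / 2 by field; rewrite gt_eqF.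
lra.
Qed.

(** Euclidean, so that it can be differentiated at a minimiser; the ambient max norm cannot in
    general. The next two lemmas compare them. *)
Definition sqdist (u v : 'cV[R]_n) : R := \sum_i (u i 0 - v i 0) ^+ 2.

Lemma norm_le_sqdist (u v : 'cV[R]_n) : `|u - v| ^+ 2 <= sqdist u v.
Proof.
have s0 : 0 <= sqdist u v by apply: sumr_ge0 => i _; exact: sqr_ge0.
rewrite -(sqr_sqrtr s0) lerXn2r ?nnegrE ?sqrtr_ge0//.
apply: mx_norm_le => [|i j]; first exact: sqrtr_ge0.
rewrite ord1 -sqrtr_sqr ler_wsqrtr// !mxE /sqdist (bigD1 i)//= lerDl.
by apply: sumr_ge0 => k _; exact: sqr_ge0.
Qed.

Lemma sqdist_le_norm (u v : 'cV[R]_n) : sqdist u v <= n%:R * `|u - v| ^+ 2.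
Proof.
apply: (@le_trans _ _ (\sum_(i < n) `|u - v| ^+ 2)).
  apply: ler_sum => i _; rewrite -[leLHS]real_normK ?num_real// lerXn2r ?nnegrE//.
  by have := mx_norm_entry (u - v) i 0; rewrite !mxE.
by rewrite sumr_const card_ord -(mulr_natl (_ ^+ 2)).
Qed.

(* In the direction [DF(x)^-1 (y - F x)] the squared distance from [F] to [y]
   has derivative [-2 |y - F x|^2] at [x]. *)
Lemma local_min_sqdist F x y :
  (forall z, differentiable F z) -> jac F x \in unitmx ->
  (\forall z \near x, sqdist (F x) y <= sqdist (F z) y) -> F x = y.
Proof.
move=> dF uF xmin.
pose v := invmx (jac F x) *m (y - F x).
pose phi (t : R) := sqdist (F (x + t *: v)) y.
pose dphi (t : R) := \sum_i (2 * (F (x + t *: v) i 0 - y i 0) * (jac F (x + t *: v) *m v) i 0).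
have phiD (t : R) : is_derive t 1 phi (dphi t).
  have -> : phi = \sum_i (fun t : R => F (x + t *: v) i 0 - y i 0) ^+ 2.
    by apply/funext => s; rewrite /phi /sqdist fct_sumE; apply: eq_bigr => i _; rewrite fctE.
  apply: is_derive_sum => i.
  have dFi := is_derive_line F x v t i (dF _).
  apply: (is_derive_eq (is_deriveX 2 (is_deriveB dFi (is_derive_cst (y i 0) t 1)))).
  by rewrite expr1 subr0.
have [e e0 emin] : exists2 e : R, 0 < e & forall t, t \in `]- e, e[ -> phi 0 <= phi t.
  have : (fun t : R => x + t *: v) @ (0 : R) --> x.
    rewrite -[X in _ --> X]addr0 -(scale0r v); apply: cvgD; first exact: cvg_cst.
    exact: scalel_continuous.
  move=> /(_ _ xmin) /nbhs_ballP[e /= e0 emin]; exists e => // t te.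
  rewrite {1}/phi scale0r addr0; apply: emin; rewrite -ball_normE/= sub0r normrN.
  by rewrite ltr_norml; move: te; rewrite in_itv.
have d0 : is_derive (0 : R) 1 phi 0.
  apply: (@derive1_at_min _ phi (- e) e) => //; first by rewrite lerNl; lra.
    by rewrite in_itv/= oppr_lt0 e0.
have := @derive_val _ _ _ _ _ _ _ (phiD 0).
rewrite (@derive_val _ _ _ _ _ _ _ d0) /dphi scale0r addr0 mulKVmx// => /esym s0.
have : sqdist (F x) y = 0.
  have : - 2 * sqdist (F x) y = 0; last by lra.
  by rewrite -[RHS]s0 mulr_sumr; apply: eq_bigr => i _; rewrite !mxE; ring.
move=> sz; apply/eqP; rewrite -subr_eq0 -normr_eq0 -sqrf_eq0.
by rewrite eq_le sqr_ge0 andbT -sz norm_le_sqdist.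
Qed.

Lemma continuous_sqdist F y : continuous F -> continuous (fun z => sqdist (F z) y).
Proof.
move=> cF z.
apply: (@cvg_big R _ +%R 0 xpredT (@add_continuous R) _ (nbhs z) _
  (fun i z => (F z i 0 - y i 0) ^+ 2)) => i _.
have cFi : F t i 0 - y i 0 @[t --> z] --> F z i 0 - y i 0.
  apply: (@cvgB _ _ _ (nbhs z)); last exact: cvg_cst.
  by apply: (cvg_comp F (fun M : 'cV[R]_n => M i 0) (cF z)); exact: coord_continuous.
exact: cvgM.
Qed.

Section Inverse.
Variables F G : 'cV[R]_n -> 'cV[R]_n.
Hypotheses (dF : forall z, differentiable F z) (uF : forall z, jac F z \in unitmx).
Hypotheses (FK : cancel F G) (GK : cancel G F).

Lemma continuous_inverse : continuous G.
Proof.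
move=> y0; rewrite -{1}(GK y0); set x0 := G y0.
apply/(@cvgrPdist_le _ _ _ (nbhs (F x0))) => e e0.
have [C C0 /nbhs_ballP[r0 /= r00 expand]] := jac_unit_expand F x0 (dF x0) (uF x0).
pose r := Num.min e (r0 / 2).
have r_gt0 : 0 < r by rewrite lt_min e0 divr_gt0.
have re : r <= e by rewrite ge_min lexx.
have rr0 : r < r0.
  by rewrite (@le_lt_trans _ _ (r0 / 2)) ?ge_min ?lexx ?orbT// ltr_pdivrMr// ltr_pMr// ltr1n.
(* Chosen so that [C (n + 2) d = r]: where [|x - x0| = r], expansion gives
   [|F x - F x0| >= (n + 2) d], hence [|F x - y| >= (n + 1) d]. *)
pose d := r / (C * n.+2%:R).
have d0 : 0 < d by rewrite divr_gt0// mulr_gt0.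
have rE : r = C * (n.+2%:R * d).
  by rewrite [RHS]mulrA [RHS]mulrC divfK// mulf_neq0// gt_eqF.
apply/nbhs_ballP; exists d => //= y; rewrite -ball_normE/= => yd.
pose K := [set x : 'cV[R]_n | `|x - x0| <= r].
have cK : compact K by apply: compact_cV_ball; exact: ltW.
have K0 : K x0 by rewrite /K/= subrr normr0 ltW.
have [|x] := compact_EVT_min (ex_intro _ x0 K0) cK (f := fun z => sqdist (F z) y).
  apply: continuous_subspaceT; apply: continuous_sqdist => z.
  exact: differentiable_continuous.
rewrite inE => Kx xmin.
(* The minimum is at most the value at the centre [x0], where [|F x0 - y| < d]. *)
have small : sqdist (F x) y <= n%:R * d ^+ 2.
  apply: (le_trans (xmin x0 _)); first by rewrite inE.
  apply: (le_trans (sqdist_le_norm _ _)); rewrite ler_wpM2l//.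
  by rewrite lerXn2r ?nnegrE ?(ltW d0)// ltW.
have xr : `|x - x0| < r.
  rewrite lt_neqAle Kx andbT; apply/eqP => xr.
  have := expand x; rewrite -ball_normE/= distrC xr => /(_ rr0).
  rewrite {1}rE ler_pM2l// => ex.
  have : n.+1%:R * d <= `|F x - y|.
    have := ler_distD y (F x) (F x0); rewrite (distrC y) => ?.
    have : n.+2%:R * d = n.+1%:R * d + d by rewrite -natr1 mulrDl mul1r.
    lra.
  (* A boundary minimiser would give [(n + 1)^2 d^2 <= n d^2]. *)
  move=> h; have := le_trans (norm_le_sqdist _ _) small; apply/negP; rewrite -ltNge.
  apply: (@lt_le_trans _ _ ((n.+1%:R * d) ^+ 2)).
    rewrite [ltRHS]exprMn ltr_pM2r ?exprn_gt0// -natrX ltr_nat expnS expn1.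
    by rewrite (leq_trans (leqnn n.+1))// leq_pmulr.
  by rewrite lerXn2r ?nnegrE// mulr_ge0// ltW.
have Fxy : F x = y.
  apply: local_min_sqdist => //.
  apply/nbhs_ballP; exists (r - `|x - x0|); first by rewrite /= subr_gt0.
  move=> z; rewrite -ball_normE/= => xz; apply: xmin; rewrite inE /K/=.
  by have := ler_distD x z x0; rewrite (distrC z x); lra.
(* Since [F x = y], the minimiser [x] is [G y], and it lies within [r <= e] of [x0]. *)
by rewrite -Fxy !FK distrC (le_trans Kx).
Qed.

(** The error for [G] at [y] is [- B] applied to the error for [F] at [x = G y], which is small
    relative to [|G z - x|]; expansion bounds [|G z - x|] by [C |z - y|]. Continuity of [G] carries
    both neighbourhoods of [x] back to [y]. *)
Lemma jac_inverse y : differentiable G y /\ jac G y = invmx (jac F (G y)).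
Proof.
apply: approx_jac => e e0.
set x := G y; set B := invmx (jac F x).
have [C C0 expand] := jac_unit_expand F x (dF x) (uF x).
pose D : R := n%:R * `|B| + 1.
have D0 : 0 < D by rewrite ltr_wpDl// mulr_ge0.
have d0 : 0 < e / (C * D) by rewrite divr_gt0// mulr_gt0.
have approx := jac_approx F x (dF x) _ d0.
have := continuous_inverse y _ (@filterI _ (nbhs x) _ _ _ expand approx).
move=> /(_ (nbhs_filter x)); rewrite nbhs_simpl; apply: (@filterS _ (nbhs y)) => z /= [].
rewrite !GK => xz zx.
have -> : G z - x - B *m (z - y) = - (B *m (z - y - jac F x *m (G z - x))).
  by rewrite [in RHS]mulmxBr mulKmx ?uF// opprB.
rewrite normrN (le_trans (mx_norm_mul _ _))//.
apply: (@le_trans _ _ (D * (e / (C * D) * `|G z - x|))).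
  by apply: ler_pM => //; rewrite ?mulr_ge0// /D lerDl.
have -> : D * (e / (C * D) * `|G z - x|) = e / C * `|G z - x|.
  by field; rewrite !gt_eqF.
by rewrite mulrAC ler_pdivrMr// -mulrA ler_pM2l// mulrC.
Qed.

End Inverse.

End InverseFunction.

(** * Integrating a Jacobian along a ray from the origin *)

Section RayIntegral.
Context {R : realType}.
Notation mu := (@lebesgue_measure R).

Lemma integrable01 (g : R -> R) : continuous g -> mu.-integrable `[0, 1] (EFin \o g).
Proof.
move=> cg; apply: continuous_compact_integrable; first exact: segment_compact.
exact: continuous_subspaceT.
Qed.

Lemma Rintegral01_sum {n : nat} (g : 'I_n -> R -> R) : (forall i, continuous (g i)) ->
  \int[mu]_(s in `[0, 1]) (\sum_i g i s) = \sum_i \int[mu]_(s in `[0, 1]) g i s.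
Proof.
move=> cg; rewrite /Rintegral.
under eq_integral do rewrite -sumEFin.
rewrite integral_sum//; last by move=> i; exact: integrable01.
by rewrite sum_fine// => i _; apply: integrable_fin_num => //; exact: integrable01.
Qed.

(** Moving [e] inside the integral turns row [i] into the integral of the derivative of
    [s |-> F_i(s e)], so the fundamental theorem of calculus applies. *)
Lemma integral_jac_ray {n m : nat} (F : 'cV[R]_n -> 'cV[R]_m) (e : 'cV[R]_n) : C1 F ->
  (\matrix_(i < m, j < n) \int[mu]_(s in `[0, 1]) (jac F (s *: e)) i j) *m e = F e - F 0.
Proof.
move=> [dF cJ]; apply/colP => i; rewrite !mxE.
have cJe j : continuous (fun s : R => jac F (s *: e) i j).
  move=> s; apply: (cvg_comp (fun s : R => jac F (s *: e)) (fun M : 'M[R]_(m, n) => M i j));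
    last exact: coord_continuous.
  have : s0 *: e @[s0 --> s] --> s *: e by exact: scalel_continuous.
  by move/cvg_comp; apply; exact: cJ.
have cJeM j : continuous (fun s : R => jac F (s *: e) i j * e j 0).
  by move=> s; apply: (@cvgMr_tmp _ _ (nbhs s)); exact: cJe.
under eq_bigr => j _.
  rewrite mxE -RintegralZr//; last exact: integrable01.
  over.
rewrite -Rintegral01_sum//.
pose g (s : R) := F (0 + s *: e) i 0.
pose g' (s : R) := \sum_j jac F (s *: e) i j * e j 0.
have dg (s : R) : is_derive s 1 g (g' s).
  have := is_derive_line F 0 e s i (dF _).
  by rewrite add0r mxE.
have cg : continuous g.
  by move=> s; apply: differentiable_continuous; apply/derivable1_diffP; exact: ex_derive.
rewrite /Rintegral (@continuous_FTC2 R g' g 0 1)//.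
- by rewrite /g scale1r scale0r !add0r.
- apply: continuous_subspaceT => s.
  apply: (@cvg_big R _ +%R 0 xpredT (@add_continuous R) _ (nbhs s) _
     (fun j s => jac F (s *: e) i j * e j 0)) => j _.
  exact: cJeM.
- split; [by move=> s _; exact: ex_derive|apply: cvg_at_right_filter|apply: cvg_at_left_filter];
    exact: cg.
- by move=> s _; rewrite derive1E; exact: derive_val.
Qed.

Lemma Mmat_mul {n : nat} (f eta etainv : 'cV[R]_n -> 'cV[R]_n) z :
  C1 f -> C1 eta -> cancel eta etainv -> cancel etainv eta ->
  f (etainv 0) = 0 -> (forall x, jac eta x \in unitmx) ->
  Mmat f eta etainv z *m eta z = f z.
Proof.
move=> [df cf] [de ce] etaK etainvK f0 ue.
have di y : differentiable etainv y by have [] := jac_inverse _ _ de ue etaK etainvK y.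
have ci : continuous etainv by exact: (continuous_inverse eta etainv).
have C1fi : C1 (f \o etainv).
  split=> [y|]; first exact: differentiable_comp.
  (* The chain rule and [jac_inverse] exhibit the Jacobian as a product of continuous maps. *)
  have -> : jac (f \o etainv) = fun y => jac f (etainv y) *m invmx (jac eta (etainv y)).
    apply/funext => y; rewrite jac_comp//.
    by have [_ ->] := jac_inverse _ _ de ue etaK etainvK y.
  apply: continuous_mulmx.
    by move=> y; apply: (cvg_comp etainv (jac f) (ci y)); exact: cf.
  apply: (continuous_invmx (fun y => jac eta (etainv y))) => y; first exact: ue.
  by apply: (cvg_comp etainv (jac eta) (ci y)); exact: ce.
by rewrite /Mmat integral_jac_ray//= etaK f0 subr0.
Qed.

End RayIntegral.

(** * Quadratic forms, skew completions and oblique projections *)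

Section QuadraticForm.
Context {R : realType} {n : nat}.
Implicit Types (A M : 'M[R]_n) (e w x : 'cV[R]_n).

Definition quad A x : R := (x^T *m A *m x) 0 0.

Lemma quadD A B x : quad (A + B) x = quad A x + quad B x.
Proof. by rewrite /quad mulmxDr mulmxDl mxE. Qed.

Lemma quadN A x : quad (- A) x = - quad A x.
Proof. by rewrite /quad mulmxN mulNmx mxE. Qed.

Lemma quadZ a A x : quad (a *: A) x = a * quad A x.
Proof. by rewrite /quad -scalemxAr -scalemxAl mxE. Qed.

Lemma tr_mx11 (a : 'M[R]_1) : a^T = a.
Proof. by rewrite [a]mx11_scalar tr_scalar_mx. Qed.

Lemma quad_tr A x : quad A^T x = quad A x.
Proof. by rewrite /quad -[x^T *m A *m x]tr_mx11 !trmx_mul trmxK mulmxA. Qed.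

Lemma quad_symH A x : quad (symH A) x = quad A x.
Proof. by rewrite /symH quadZ quadD quad_tr; field. Qed.

Lemma quad_skew A x : A^T = - A -> quad A x = 0.
Proof. by move=> As; have := quad_tr A x; rewrite As quadN; lra. Qed.

Lemma tr_symH A : (symH A)^T = symH A.
Proof. by rewrite /symH linearZ linearD /= trmxK addrC. Qed.

Lemma cV_neq0_entry e : e != 0 -> exists i, e i 0 != 0.
Proof.
move=> e0; apply/existsP; apply: contraNT e0 => /existsPn e0.
by apply/eqP/colP => i; rewrite mxE; have /negPn/eqP := e0 i.
Qed.

Lemma dot_gt0 e : e != 0 -> 0 < (e^T *m e) 0 0.
Proof.
move=> /cV_neq0_entry[i ei].
rewrite mxE (bigD1 i)//= mxE ltr_pwDl//.
  by rewrite -expr2 lt_def sqrf_eq0 ei sqr_ge0.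
by apply: sumr_ge0 => j _; rewrite mxE -expr2 sqr_ge0.
Qed.

(** The witness is the rank-two skew matrix [(g e^T - e g^T) / |e|^2]; orthogonality of [g] and [e]
    kills the second term on [e]. *)
Lemma skew_solve e g : e != 0 -> (e^T *m g) 0 0 = 0 ->
  exists S : 'M[R]_n, S^T = - S /\ S *m e = g.
Proof.
move=> /dot_gt0/lt0r_neq0; set d := (e^T *m e) 0 0 => d0 eg.
have ge : g^T *m e = 0.
  by rewrite -[LHS]tr_mx11 trmx_mul trmxK [LHS]mx11_scalar eg raddf0.
exists (d^-1 *: (g *m e^T - e *m g^T)); split.
  by rewrite linearZ linearB /= !trmx_mul !trmxK -scalerN opprB.
rewrite -scalemxAl mulmxBl -!mulmxA ge mulmx0 subr0.
by rewrite [e^T *m e]mx11_scalar mul_mx_scalar scalerA mulVf// scale1r.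
Qed.

Section Oblique.
Variables (M : 'M[R]_n) (e w : 'cV[R]_n).
Hypotheses (e0 : e != 0) (Me : quad M e <= 0).
Let c := (w^T *m e) 0 0.
Hypothesis c0 : c != 0.
(** The projection onto the line of [e] along the hyperplane [w^T x = 0]. *)
Let cP := c^-1 *: (e *m w^T).
Let PH := - symH M + cP^T *m symH M *m cP.

Lemma oblique_proj x : cP *m x = (c^-1 * (w^T *m x) 0 0) *: e.
Proof.
by rewrite /cP -scalemxAl -mulmxA [in LHS](mx11_scalar (w^T *m x)) mul_mx_scalar scalerA.
Qed.

Lemma quad_congruence x : quad (cP^T *m symH M *m cP) x = (c^-1 * (w^T *m x) 0 0) ^+ 2 * quad M e.
Proof.
have -> : quad (cP^T *m symH M *m cP) x = quad (symH M) (cP *m x).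
  by rewrite /quad trmx_mul !mulmxA.
rewrite quad_symH oblique_proj /quad -scalemxAr linearZ /= -!scalemxAl.
by rewrite !mxE; ring.
Qed.

(** The solvability condition [e^T PH e = 0] holds because [cP] fixes [e], so the two terms of [PH]
    cancel on [e]. *)
Lemma oblique_skew_part : exists S : 'M[R]_n, S^T = - S /\ S *m e = - (PH *m e).
Proof.
apply: skew_solve => //; rewrite mulmxN mulmxA mxE -/(quad PH e).
by rewrite quadD quadN quad_congruence quad_symH mulVf//; ring.
Qed.

Lemma oblique_nsd (S : 'M[R]_n) : S^T = - S -> nsd (M + (PH + S)).
Proof.
move=> Sskew x; rewrite -/(quad _ x) !quadD quadN quad_symH (quad_skew S)// addr0 addrA subrr add0r.
by rewrite quad_congruence mulr_ge0_le0// sqr_ge0.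
Qed.

End Oblique.

Lemma rank1_nsd M e : quad M e <= 0 -> let q := (e^T *m symH M *m e) 0 0 in
  q != 0 ->
  let P := - symH M + q^-1 *: (symH M *m e *m e^T *m symH M) in
  nsd (M + P) /\ P *m e = 0.
Proof.
rewrite /= => Me; set q := (_ *m e) 0 0 => q0; split=> [x|].
  rewrite -/(quad _ x) !quadD quadN quad_symH addrA subrr add0r quadZ.
  have -> : quad (symH M *m e *m e^T *m symH M) x = ((e^T *m symH M *m x) 0 0) ^+ 2.
    have -> : quad (symH M *m e *m e^T *m symH M) x =
        ((x^T *m symH M *m e) *m (e^T *m symH M *m x)) 0 0 by rewrite /quad !mulmxA.
    rewrite mxE big_ord1 expr2; congr (_ * _).
    (* Symmetry of [symH M] identifies [x^T M_H e] with [e^T M_H x], which makes the rank-one term a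
       square. *)
    by rewrite -[e^T *m _ *m x]tr_mx11 !trmx_mul trmxK tr_symH mulmxA.
  by rewrite mulr_le0_ge0 ?sqr_ge0// invr_le0 /q -/(quad _ e) quad_symH.
move: @q q0; move: (symH M) => S q q0.
rewrite mulmxDl mulNmx -scalemxAl -!(mulmxA (S *m e)) [e^T *m _ *m e]mx11_scalar -/q.
by rewrite mul_mx_scalar scalerA mulVf// scale1r addNr.
Qed.

(* A nonzero coordinate of the projection onto [e] along [W] has the form
   [x |-> x^T v] with [v] orthogonal to [W] and [e^T v != 0]; [v] is then a
   multiple of [w]. *)
Lemma orth_span_dot_neq0 (W : {vspace 'cV[R]_n}) e w : e != 0 ->
  directv (<[e]> + W) -> orth_is_span W w -> (w^T *m e) 0 0 != 0.
Proof.
move=> e0 /directv_addP dW orth.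
have [k ek] := cV_neq0_entry e e0.
pose p := daddv_pi <[e]>%VS W.
pose v : 'cV[R]_n := \col_i p (delta_mx i 0) k 0.
have vE x : (x^T *m v) 0 0 = p x k 0.
  rewrite mxE [in RHS](matrix_sum_delta x) linear_sum summxE; apply: eq_bigr => i _.
  by rewrite big_ord1 linearZ !mxE.
have pW x : x \in W -> p x = 0.
  move=> xW; have /(daddv_pi_add dW) : x \in (<[e]> + W)%VS.
    by rewrite (subvP (addvSr _ _)).
  (* The projections onto the line and onto [W] sum to the identity, and the second fixes [x], so
     [p x = 0]. *)
  have dW' : (W :&: <[e]>)%VS = 0%VS by rewrite capvC.
  by rewrite (daddv_pi_id dW' xW) => px; apply: (addIr x); rewrite add0r.
have pe : p e = e by apply: daddv_pi_id => //; exact: memv_line.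
have : v \in <[w]>%VS.
  by apply/orth => x xW; apply/matrixP => i j; rewrite !ord1 vE pW// !mxE.
move=> /vlineP[a va].
(* If [w^T e] vanished, so would [e^T v], as [v] is a multiple of [w]; but [e^T v] is the coordinate
   [k] of [p e = e]. *)
apply: contraNneq ek => we.
rewrite -pe -vE va -scalemxAr mxE; apply/eqP.
rewrite (_ : (e^T *m w) 0 0 = 0) ?mulr0//.
by rewrite -we -[w^T *m e]tr_mx11 trmx_mul trmxK.
Qed.

End QuadraticForm.

Theorem mainTheorem7 (R : realType) (n : nat) (H : 'cV[R]_n -> R)
  (f eta etainv : 'cV[R]_n -> 'cV[R]_n) (z : 'cV[R]_n) :
  (0 < n)%N ->
  C1s H -> (forall x, 0 <= H x) -> (forall x, eta x = grad H x) ->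
  propertyP eta f ->
  C1 f -> C1 eta ->
  cancel eta etainv -> cancel etainv eta ->
  f (etainv 0) = 0 ->
  (forall x, jac eta x \in unitmx) ->
  eta z != 0 ->
  let M := Mmat f eta etainv z in
  let e := eta z in
  (* part 1: existence *)
  (exists P : 'M[R]_n, nsd (M + P) /\ P *m e = 0) /\
  (* part 1: the construction *)
  (forall (W : {vspace 'cV[R]_n}) (w : 'cV[R]_n),
      (<[e]> + W)%VS = fullv -> directv (<[e]> + W) -> orth_is_span W w ->
      let c := (w^T *m e) 0 0 in
      c != 0 /\
      (let cP := c^-1 *: (e *m w^T) in
       let PH := - symH M + cP^T *m symH M *m cP in
       (exists PS : 'M[R]_n, PS^T = - PS /\ PS *m e = - (PH *m e)) /\
       (forall PS : 'M[R]_n, PS^T = - PS -> PS *m e = - (PH *m e) ->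
          nsd (M + (PH + PS)) /\ (PH + PS) *m e = 0))) /\
  (* part 2 *)
  ((e^T *m symH M *m e) 0 0 != 0 ->
     let P := - symH M + ((e^T *m symH M *m e) 0 0)^-1 *: (symH M *m e *m e^T *m symH M) in
     nsd (M + P) /\ P *m e = 0).
Proof.
move=> _ _ _ _ [p [l Pl]] f1 eta1 etaK etainvK f0 ue e0 M e.
have Me : quad M e <= 0.
  rewrite /quad -mulmxA Mmat_mul// Pl mxE oppr_le0 mxE.
  by apply: sumr_ge0 => i _; rewrite mxE -expr2 sqr_ge0.
split; [|split].
(* For bare existence take [w = e], the orthogonal projection, for which [c = |e|^2]. *)
- have ee : (e^T *m e) 0 0 != 0 by rewrite gt_eqF// dot_gt0.
  have [S [Sskew Se]] := oblique_skew_part M e e e0 ee.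
  eexists; split; first exact: (oblique_nsd M e e Me S Sskew).
  by rewrite mulmxDl Se subrr.
- move=> W w _ dW orth c; split; first exact: (orth_span_dot_neq0 W e w).
  have c0 : c != 0 by exact: (orth_span_dot_neq0 W e w).
  move=> cP PH; split; first exact: oblique_skew_part.
  move=> PS PSskew PSe; split; first exact: oblique_nsd.
  by rewrite mulmxDl PSe subrr.
- exact: rank1_nsd.
Qed.
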